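(* Let $(\mathscr{L},\vdash)$ be a logical structure which is of Tarski-type and of Lindenbaum-IV-type, and let $\mathbb{SCS}$ be the set of all characteristic functions $\chi_\Sigma$ of sets $\Sigma\subseteq\mathscr{L}$ that are strongly closed and $\beta$-saturated for some $\beta\in\mathscr{L}$. Then for every $\mathcal{B}\subseteq\mathbb{SCS}$ we have $\vdash\,\subseteq\,\vdash_{\mathcal{B}}$. Moreover, if $\mathcal{B}\subsetneq\mathbb{SCS}$ then $\vdash\,\subsetneq\,\vdash_{\mathcal{B}}$.
   Context: A logical structure is a pair $(\mathscr{L},\vdash)$ with $\mathscr{L}$ a nonempty set and $\vdash\subseteq\mathcal{P}(\mathscr{L})\times\mathscr{L}$ nonempty. Tarski-type: reflexive ($\alpha\in\Gamma\Rightarrow\Gamma\vdash\alpha$), monotone ($\Gamma\vdash\alpha$, $\Gamma\subseteq\Sigma\Rightarrow\Sigma\vdash\alpha$), transitive (if $\Gamma\vdash\beta$ for all $\beta\in\Sigma$ and $\Sigma\vdash\alpha$ then $\Gamma\vdash\alpha$). $\Gamma$ is relatively maximal in $\alpha$ if $\Gamma\nvdash\alpha$ but $\Sigma\vdash\alpha$ for all $\Sigma\supsetneq\Gamma$; Lindenbaum-IV-type: whenever $\Gamma\nvdash\alpha$ there is $\Sigma\supseteq\Gamma$ relatively maximal in $\alpha$. $\Gamma$ is strongly closed if $\Gamma\vdash\alpha$ for all $\alpha\in\Gamma$ and, for all $\alpha$, if some $\Gamma'\subseteq\Gamma$ has $\Gamma'\vdash\alpha$ then $\alpha\in\Gamma$.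 $\Gamma$ is $\beta$-saturated if $\Gamma\nvdash\beta$ but $\Gamma\cup\{\gamma\}\vdash\beta$ for all $\gamma\in\mathscr{L}\setminus\Gamma$. For a set $\mathcal{V}$ of functions $v:\mathscr{L}\to\{0,1\}$, $\Gamma\vdash_{\mathcal{V}}\alpha$ iff every $v\in\mathcal{V}$ with $v(\gamma)=1$ for all $\gamma\in\Gamma$ has $v(\alpha)=1$. *)

(* Defs.v *)
From mathcomp Require Import all_boot all_classical.

Set Implicit Arguments.
Unset Strict Implicit.
Unset Printing Implicit Defensive.

Local Open Scope classical_set_scope.

Record logicalStructure := LogicalStructure {
  formula :> Type;
  entails : set (set formula * formula);
  formula_nonempty : inhabited formula;
  entails_nonempty : entails !=set0
}.

Arguments entails : clear implicits.

Notation "G |-[ L ] a" := (entails L (G, a))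
  (at level 70, L at level 200, a at next level, format "G  |-[ L ]  a").

Section LogicalStructureTheory.
Variable L : logicalStructure.
Implicit Types (G S D : set L) (a b c : L).

Definition entails_reflexive := forall G a, G a -> G |-[L] a.

Definition entails_monotone :=
  forall G S a, G |-[L] a -> G `<=` S -> S |-[L] a.

Definition entails_transitive :=
  forall G S a, (forall b, S b -> G |-[L] b) -> S |-[L] a -> G |-[L] a.

Definition Tarski_type :=
  [/\ entails_reflexive, entails_monotone & entails_transitive].

Definition relatively_maximal a G :=
  ~ (G |-[L] a) /\ forall S, G `<` S -> S |-[L] a.

Definition Lindenbaum_IV_type :=
  forall G a, ~ (G |-[L] a) ->
    exists S, G `<=` S /\ relatively_maximal a S.

Definition strongly_closed G :=
  (forall a, G a -> G |-[L] a) /\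
  (forall a, (exists D, D `<=` G /\ D |-[L] a) -> G a).

Definition saturated b G :=
  ~ (G |-[L] b) /\ forall c, ~ G c -> G `|` [set c] |-[L] b.

(* Functions into {0,1} are rendered as functions into bool. *)
Definition char_fun G : L -> bool := fun a => a \in G.

Definition SCS : set (L -> bool) :=
  char_fun @` [set S | strongly_closed S /\ exists b, saturated b S].

Definition val_entails (V : set (L -> bool)) : set (set L * L) :=
  [set p | forall v, V v -> (forall c, p.1 c -> v c = true) -> v p.2 = true].

End LogicalStructureTheory.

Arguments Tarski_type : clear implicits.
Arguments Lindenbaum_IV_type : clear implicits.
Arguments SCS : clear implicits.

(* Main.v *)
(** If S is b-saturated, the only strongly closed set including S and omitting
    b is S itself, since any further element c gives S `|` [set c] |- b.  So
    dropping char_fun S from the valuations makes b follow from S. *)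
Require Import Defs.
From mathcomp Require Import all_boot all_classical.

Local Open Scope classical_set_scope.

Lemma char_funP (L : logicalStructure) (G : set L) (a : L) :
  char_fun G a = true <-> G a.
Proof. by rewrite /char_fun; split=> [/set_mem|/mem_set]. Qed.

(** A strongly closed set contains whatever its subsets entail; the subset to take is [G] itself. *)
Lemma SCS_sound (L : logicalStructure) (B : set (L -> bool)) :
  B `<=` SCS L -> entails L `<=` val_entails B.
Proof.
move=> sB [G a] /= Ga v /sB [S [[_ clS] _] <-] GS.
apply/char_funP/clS; exists G; split=> // c /GS.
by move/char_funP.
Qed.

Lemma saturated_eq (L : logicalStructure) (b : L) (S D : set L) :
  saturated b S -> strongly_closed D -> S `<=` D -> ~ D b -> S = D.
Proof.
move=> [_ satS] [_ clD] SD nDb; apply/seteqP; split=> // c Dc.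
apply: contrapT => nSc; apply: nDb; apply: clD.
by exists (S `|` [set c]); split; [move=> x [/SD|->] | exact: satS].
Qed.

Theorem mainTheorem5 (L : logicalStructure)
    (tarskiL : Tarski_type L) (lindenbaumL : Lindenbaum_IV_type L) :
  (forall B : set (L -> bool),
      B `<=` SCS L -> entails L `<=` val_entails B) /\
  (forall B : set (L -> bool),
      B `<` SCS L -> entails L `<` val_entails B).
Proof.
split=> [|B [sB nsB]]; first exact: SCS_sound.
split; first exact: SCS_sound.
(* If the inclusion were not strict, [B] would contain every [char_fun S] in [SCS L], against
   properness. *)
move=> complete; apply: nsB => _ [S [_ [b satS]] <-].
apply: contrapT => nBS; case: (satS) => + _; apply.
(* By [complete], that [S] entails [b] may be checked on the valuations in [B]. *)
apply: complete => v Bv Sv /=.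
have [D [clD _] Dv] := sB v Bv; subst v.
apply/char_funP; apply: contrapT => nDb; apply: nBS.
(* [D] includes [S] and omits [b], so [D] is [S] and [Bv] puts [char_fun S] in [B]. *)
rewrite (saturated_eq _ _ _ _ satS clD _ nDb) // => c Sc.
exact/char_funP/Sv.
Qed.
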